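(* Let $M_1=(J,\Sigma,\mu,\mathcal F_1)$ and $M_2=(J,\Sigma,\mu,\mathcal F_2)$ be measurable matroids on the same standard measure space, of common rank $R$ (that is, $r_1(J)=r_2(J)=R$). Suppose that there exist $\varepsilon>0$ and $\theta\in[0,1]$ such that the following conditions hold. (a) The ordered pair $(M_1,M_2)$ is either $(\varepsilon,\theta)$-expanding or $(\varepsilon,\theta)$-co-expanding. (b) The ordered pair $(M_2,M_1)$ is either $(\varepsilon,1-\theta)$-expanding or $(\varepsilon,1-\theta)$-co-expanding. Then $M_1$ and $M_2$ have a common basis.
   Context: A standard measure space $(J,\Sigma,\mu)$ is a standard Borel space $(J,\Sigma)$ with a finite atomless measure $\mu\colon\Sigma\to[0,\infty)$. Convention: measurable sets are identified when they differ by a $\mu$-null set: $A=B$ means $\mu(A\triangle B)=0$, $A\subseteq B$ means $\mu(A\setminus B)=0$, and families of measurable sets are families in the measure algebra (membership is unaffected by null modifications). All sets are assumed measurable. A set $X$ in a family $\mathcal X$ is maximal in $\mathcal X$ if $X\subseteq Y\in\mathcal X$ implies $Y\subseteq X$. Write $\mathcal X|Z=\{X\in\mathcal X\mid X\subseteq Z\}$. A measurable matroid $M=(J,\Sigma,\mu,\mathcal F)$ consists of a standard measure space and a family $\mathcal F\subseteq\Sigma$ (the independent sets) satisfying: (I1) $\emptyset\in\mathcal F$; (I2) $F_1\subseteq F_2\in\mathcal F$ implies $F_1\in\mathcal F$; (I3) for all $X\in\Sigma$ and all maximal $F_1,F_2\in\mathcal F|X$, $\mu(F_1)=\mu(F_2)$;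 (I4) if $(F_i)_{i\in\mathbb N}$ is an increasing sequence in $\mathcal F$, then $\bigcup_i F_i\in\mathcal F$. Bases are the maximal members of $\mathcal F$. The rank function is $r(X)=\mu(F)$ for any maximal $F\in\mathcal F|X$ (such $F$ exists and the value does not depend on the choice); the rank of $M$ is $r(J)$. The closure $\mathrm{cl}(X)$ of $X\in\Sigma$ is the unique maximal set in $\{A\in\Sigma\mid X\subseteq A,\ r(A)=r(X)\}$ (it exists). A set $C$ is $M$-closed if $\mathrm{cl}(C)=C$. Let $M,M'$ be measurable matroids on $(J,\Sigma,\mu)$ of common rank $R$, with rank functions $r,r'$, and let $\mathrm{cl}$ be the closure operator of $M$. Let $\varepsilon>0$ and $\alpha\in[0,1]$. The ordered pair $(M,M')$ is $(\varepsilon,\alpha)$-expanding if for every $M$-closed set $C$, $$r'(C\setminus\mathrm{cl}(\emptyset))\ge\alpha R\quad\text{or}\quad r'(C\setminus\mathrm{cl}(\emptyset))\ge(1+\varepsilon)\,r(C\setminus\mathrm{cl}(\emptyset)).$$ It is $(\varepsilon,\alpha)$-co-expanding if for every $M$-closed set $C$, $$r'(J\setminus C)\ge\alpha R\quad\text{or}\quad r'(J\setminus C)\ge(1+\varepsilon)\,r(J\setminus C).$$ *)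

(* Defs.v *)
From HB Require Import structures.
From mathcomp Require Import all_boot all_order all_algebra.
From mathcomp Require Import all_classical all_reals all_analysis.
Import Order.TTheory GRing.Theory Num.Theory.
Import numFieldNormedType.Exports.

Set Implicit Arguments.
Unset Strict Implicit.
Unset Printing Implicit Defensive.

Local Open Scope classical_set_scope.
Local Open Scope ring_scope.

(* A measurable space is standard Borel when it is isomorphic to a Polish space
   with its Borel sigma-algebra. In the library, a metric space is a Hausdorff
   pseudometric space. *)
Definition standard_borel (R : realType) d (T : measurableType d) : Prop :=
  exists (P : completePseudoMetricType R) (f : T -> P),
    [/\ hausdorff_space P,
        exists2 D : set P, countable D & dense D,
        bijective f &
        forall A : set T, measurable A <-> <<s @open P >> (f @` A)].

Definition atomless d (T : measurableType d) (R : realType)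
    (mu : set T -> \bar R) : Prop :=
  forall A, measurable A -> (0 < mu A)%E ->
    exists B, [/\ measurable B, B `<=` A, (0 < mu B)%E & (mu B < mu A)%E].

Definition standard_measure_space d (T : measurableType d) (R : realType)
    (mu : {finite_measure set T -> \bar R}) : Prop :=
  standard_borel R T /\ atomless mu.

(* Instead of quotienting by null sets, inclusion, equality and maximality of
   measurable sets are taken modulo mu throughout. *)
Definition ae_subset d (T : measurableType d) (R : realType)
    (mu : set T -> \bar R) (A B : set T) : Prop := mu (A `\` B) = 0%E.

Definition ae_eq_set d (T : measurableType d) (R : realType)
    (mu : set T -> \bar R) (A B : set T) : Prop := mu (A `+` B) = 0%E.

Definition maximal_in d (T : measurableType d) (R : realType)
    (mu : set T -> \bar R) (XX : set (set T)) (X : set T) : Prop :=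
  XX X /\ forall Y, XX Y -> ae_subset mu X Y -> ae_subset mu Y X.

Definition restr_family d (T : measurableType d) (R : realType)
    (mu : set T -> \bar R) (XX : set (set T)) (Z : set T) : set (set T) :=
  [set X | XX X /\ ae_subset mu X Z].

(* Since inclusion is modulo mu, [indepS] also says that [indep] is invariant
   under null modifications, i.e. that it is a family in the measure algebra. *)
Record measurable_matroid d (T : measurableType d) (R : realType)
    (mu : {finite_measure set T -> \bar R}) := MeasurableMatroid {
  indep : set (set T) ;
  indep_measurable : forall F, indep F -> measurable F ;
  indep0 : indep set0 ;
  indepS : forall F1 F2, measurable F1 ->
    ae_subset mu F1 F2 -> indep F2 -> indep F1 ;
  indep_maximal : forall X, measurable X -> forall F1 F2,
    maximal_in mu (restr_family mu indep X) F1 ->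
    maximal_in mu (restr_family mu indep X) F2 -> mu F1 = mu F2 ;
  indep_bigcup : forall F : nat -> set T, (forall i, indep (F i)) ->
    (forall i, ae_subset mu (F i) (F i.+1)) -> indep (\bigcup_i F i)
}.

Section matroid_notions.
Context d (T : measurableType d) (R : realType).
Variable mu : {finite_measure set T -> \bar R}.
Implicit Types (M : measurable_matroid mu) (X C : set T) (eps alpha : R).

Definition basis_of_matroid M : set (set T) := maximal_in mu (indep M).

(* [xget set0] picks an element of a set, which is nonempty here and in [cl]
   when X is measurable; [set0] is only a default value. *)
Definition rank M X : R :=
  fine (mu (xget set0 [set F | maximal_in mu (restr_family mu (indep M) X) F])).

(* The maximal set is unique only up to a null set, and so is [cl M X]. *)
Definition cl M X : set T :=
  xget set0 [set B | maximal_in mu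
    [set A | [/\ measurable A, ae_subset mu X A & rank M A = rank M X]] B].

Definition matroid_closed M C : Prop :=
  measurable C /\ ae_eq_set mu (cl M C) C.

(* The next two notions are used for M and M' of the same rank, written here
   as [rank M setT]. *)
Definition expanding M M' eps alpha : Prop :=
  forall C, matroid_closed M C ->
    rank M' (C `\` cl M set0) >= alpha * rank M setT \/
    rank M' (C `\` cl M set0) >= (1 + eps) * rank M (C `\` cl M set0).

Definition co_expanding M M' eps alpha : Prop :=
  forall C, matroid_closed M C ->
    rank M' (setT `\` C) >= alpha * rank M setT \/
    rank M' (setT `\` C) >= (1 + eps) * rank M (setT `\` C).

End matroid_notions.

(* Main.v *)
Require Import Defs.
From mathcomp Require Import all_boot all_order all_algebra ring lra.
From mathcomp Require Import all_classical all_reals all_analysis.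
Import Order.TTheory GRing.Theory Num.Theory.

Set Implicit Arguments.
Unset Strict Implicit.
Unset Printing Implicit Defensive.

Local Open Scope classical_set_scope.
Local Open Scope ring_scope.

(** The proof augments a common independent set [I] along short alternating
chains, as in the finite matroid intersection algorithm, and shows that the
total change is finite, so that the process converges.

Both forms of expansion say the same thing about an independent set [G] of
[M1]: the elements outside the closure of [G] have [M2]-rank at least
[(1 + eps) * (rk - vol G)], or at least [theta * rk]
([expands_outside_of]). Given a common independent set [I] of defect
[rk - vol I > 0], build layers [A_0 = set0, A_1, A_2, ...] of subsets of [I]:
[Z_i] is the set of elements outside the [M1]-closure of [I \ A_i], and
[A_{i+1}] is a minimal subset of [I] containing [A_i] that spans [Z_i] in [M2].
If instead [I] itself fails to span [Z_i] in [M2], a set of positive measure in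
[Z_i] can be added to [I] in [M2], and pulling it back through the layers gives
a strictly larger common independent set ([exchange_layer_augment],
[exchange_layer_extend]). The elements of [Z_i] that are not in [Z_{i-1}] lie
in the [M1]-closure of [I \ A_{i-1}], so that the exchange they take part in
leaves the earlier layers alone, while in [M2] the earlier exchanges preserve the
span of [A_i]; this is why the exchanges between consecutive layers, each
legitimate on its own, remain legitimate together. An augmentation through [i]
layers changes [I] by at most [2 i + 1] times the measure that it gains.

While no augmentation is found, the expansion of [M1] makes
[rk - vol I + vol A_i] grow by a factor [1 + eps] at each layer until [A_i] has
measure [theta * rk]. From then on, the expansion of [M2] makes
[rk - vol A_i] shrink by the factor [1 + eps] ([exchange_layer_grow]). Since
[vol A_i <= vol I < rk], an augmentation is found within a number of layers
logarithmic in the inverse of the defect, in particular at most a constant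
divided by the square root of the defect ([augmentation_rate]). Only some gain
is guaranteed, and it may be tiny; but the rate bound says that the square root
of the defect decreases by at least a constant times the change of [I]. Hence
along any sequence of improvements the changes are summable and the lower limit
of the sequence is again a common independent set, so that an exhaustion
argument in the style of Ekeland and Caristi produces a common independent set
that cannot be improved; it has full rank ([exists_full]). *)

(** * Exhaustion *)

(** A greedy argument: at step [n], move to an element whose value is within
[1 / (n + 1)] of the best that remains reachable. An upper bound of the
resulting sequence can then no longer be improved. *)
Lemma exhaustion (R : realType) (S : Type) (le : S -> S -> Prop) (phi : S -> R)
    (b : R) :
  (forall x, le x x) -> (forall x y z, le x y -> le y z -> le x z) ->
  (forall x y, le x y -> phi x <= phi y) -> (forall x, phi x <= b) ->
  (forall u : nat -> S, (forall n, le (u n) (u n.+1)) ->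
    exists w, forall n, le (u n) w) ->
  forall x, exists2 y, le x y & forall z, le y z -> phi z <= phi y.
Proof.
move=> le_refl le_trans phi_mono phi_b chain x.
(* The index is part of the argument so that one choice function serves all
   steps. *)
have step (yn : S * nat) : exists z, le yn.1 z /\
    forall w, le yn.1 w -> phi w <= phi z + yn.2.+1%:R^-1.
  case: yn => y n /=; set E := [set phi z | z in [set z | le y z]].
  have [||_ [z yz <-] ltz] := @sup_adherent _ E n.+1%:R^-1; last 1 first.
  - exists z; split=> // w yw; rewrite -lerBlDr ltW// (le_lt_trans _ ltz)//.
    rewrite lerD2r; apply: ub_le_sup; last by exists w.
    by exists b => _ [v _ <-].
  - by rewrite invr_gt0.
  - by split; [exists (phi y), y | exists b => _ [v _ <-]].
have [f fP] := choice step.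
pose u := fix u n := if n is n'.+1 then f (u n', n') else x.
have uS n : le (u n) (u n.+1) by have [] := fP (u n, n).
have [y uy] := chain u uS.
exists y; first exact: (uy 0%N).
move=> z yz; rewrite leNgt; apply/negP => ltyz.
have [n nlt] := ltr_add_invr ltyz.
have [_ /(_ z (le_trans _ _ _ (uy n) yz))] := fP (u n, n).
have := phi_mono _ _ (uy n.+1 : le (f (u n, n)) y).
move: nlt; rewrite [(_, n).2]/=; move: (n.+1%:R^-1) => e h1 h2 h3.
by lra.
Qed.

(** * Boolean combinations of sets *)

(* Measurability of Boolean combinations, as a side condition closed by [//]. *)
Ltac measurability :=
  repeat first [ assumption | exact: measurable0 | exact: measurableT
    | apply: measurableU | apply: measurableI | apply: measurableD
    | apply: measurableC ].
#[local] Hint Extern 0 (measurable _) => solve [measurability] : core.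

Lemma Prop_bool (P : Prop) : exists b : bool, P = b.
Proof. by exists `[< P >]; apply/propext; split=> /asboolP. Qed.

(** A name for implication, which makes it a connective that [rewrite] can turn
into [==>]. *)
Definition imp (P Q : Prop) : Prop := P -> Q.

Lemma imp_elim P Q G : imp P Q -> imp (imp P Q) G -> G.
Proof. by move=> PQ; exact. Qed.

Lemma subset_imp (T : Type) (A B : set T) :
  (forall x, imp (A x) (B x)) -> A `<=` B.
Proof. by []. Qed.

Lemma Prop_boolE : (True = true :> Prop) * (False = false :> Prop) *
  (forall a b : bool, (a /\ b) = (a && b) :> Prop) *
  (forall a b : bool, (a \/ b) = (a || b) :> Prop) *
  (forall a : bool, (~ a) = (~~ a) :> Prop) *
  (forall a b : bool, imp a b = (a ==> b) :> Prop).
Proof.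
do !split=> *; apply/propext; split=> //.
- by move/andP.
- by move/andP.
- by move/orP.
- by move/orP.
- by move/negP.
- by move/negP.
- by move/implyP.
- by move/implyP.
Qed.

Definition all_bool (f : bool -> bool) := f true && f false.

Lemma all_boolP (f : bool -> bool) : all_bool f -> forall b, f b.
Proof. by move=> /andP[ft ff] []. Qed.

(* Decides an inclusion or an equality between Boolean combinations of sets,
   given the inclusions of the context: membership of a point turns it into a
   propositional tautology, checked by truth table. *)
Ltac sets :=
  lazymatch goal with |- _ = _ => apply/seteqP; split | _ => idtac end;
  apply: subset_imp;
  let x := fresh "x" in move=> x;
  repeat match goal with H : _ `<=` _ |- _ =>
    apply: (imp_elim (H x)); clear H end;
  rewrite /=;
  repeat match goal with |- context [?X x] =>
    let b := fresh "b" in have [b ->] := Prop_bool (X x) end;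
  rewrite !Prop_boolE;
  repeat match goal with b : bool |- _ => move: b; apply: all_boolP end;
  vm_compute; reflexivity.

(** * Finite measures with real values *)

Section Volume.
Context (R : realType) d (T : measurableType d).
Variable mu : {finite_measure set T -> \bar R}.
Implicit Types A B C : set T.

Definition vol A : R := fine (mu A).

Lemma volE A : measurable A -> mu A = (vol A)%:E.
Proof. by move=> mA; rewrite /vol fineK// fin_num_measure. Qed.

Lemma vol0 : vol set0 = 0. Proof. by rewrite /vol measure0. Qed.

Lemma vol_ge0 A : 0 <= vol A.
Proof. exact/fine_ge0/measure_ge0. Qed.

Lemma le_vol A B : measurable A -> measurable B -> A `<=` B -> vol A <= vol B.
Proof.
by move=> mA mB AB; rewrite -lee_fin -!volE// le_measure// inE.
Qed.

Lemma volID A B : measurable A -> measurable B ->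
  vol A = vol (A `\` B) + vol (A `&` B).
Proof.
move=> mA mB; apply: EFin_inj; rewrite EFinD -!volE//; exact: measureDI.
Qed.

Lemma volD A B : measurable A -> measurable B -> B `<=` A ->
  vol (A `\` B) = vol A - vol B.
Proof. by move=> mA mB BA; rewrite (volID mA mB) setIidr ?addrK. Qed.

Lemma volU A B : measurable A -> measurable B -> A `&` B `<=` set0 ->
  vol (A `|` B) = vol A + vol B.
Proof.
move=> mA mB AB; apply: EFin_inj; rewrite EFinD -!volE//; apply: measureU => //.
exact/seteqP.
Qed.

Lemma volUI A B : measurable A -> measurable B ->
  vol (A `|` B) + vol (A `&` B) = vol A + vol B.
Proof.
move=> mA mB; have -> : A `|` B = A `|` (B `\` A) by sets.
rewrite volU//; last by sets.
by rewrite [A `&` B]setIC [vol B](volID mB mA) addrA.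
Qed.

Lemma volU_le A B : measurable A -> measurable B ->
  vol (A `|` B) <= vol A + vol B.
Proof. by move=> mA mB; rewrite -volUI// lerDl vol_ge0. Qed.

Lemma ae_subset_vol A B : ae_subset mu A B -> vol (A `\` B) = 0.
Proof. by rewrite /vol => ->. Qed.

Lemma vol_null A : measurable A -> vol A <= 0 -> mu A = 0%E.
Proof.
by move=> mA A0; rewrite volE//; congr EFin; apply/eqP; rewrite eq_le A0 vol_ge0.
Qed.

Lemma vol_ae_subset A B : measurable A -> measurable B ->
  vol (A `\` B) <= 0 -> ae_subset mu A B.
Proof. by move=> mA mB; exact: vol_null. Qed.

Lemma subset_ae A B : A `<=` B -> ae_subset mu A B.
Proof. by rewrite -setD_eq0 /ae_subset => ->; rewrite measure0. Qed.

Lemma vol_bigcup_le (F : nat -> set T) (c : R) :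
  (forall n, measurable (F n)) -> (forall n, F n `<=` F n.+1) ->
  (forall n, vol (F n) <= c) -> vol (\bigcup_n F n) <= c.
Proof.
move=> mF FS Fc.
have mU : measurable (\bigcup_n F n) by exact: bigcup_measurable.
have F_mono : {homo F : n m / (n <= m)%N >-> (n <= m)%O}.
  by apply: homo_leq => [A //|A B C|n]; [exact: le_trans | exact/subsetPset].
rewrite -lee_fin -volE//.
have cv := @nondecreasing_cvg_mu _ _ _ mu _ mF mU F_mono.
rewrite -(cvg_lim _ cv)//; apply: lime_le.
  by apply/cvg_ex; eexists; exact: cv.
by apply: nearW => n /=; rewrite volE// lee_fin.
Qed.

(** The form of exhaustion used in place of Zorn's lemma: only countable
increasing unions are available, and the bounded volume makes them suffice. *)
Lemma set_exhaustion (P : set T -> Prop) A :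
  (forall X, P X -> measurable X) ->
  (forall F : nat -> set T, (forall n, P (F n)) ->
    (forall n, F n `<=` F n.+1) -> P (\bigcup_n F n)) ->
  P A -> exists B, [/\ P B, A `<=` B &
    forall C, P C -> B `<=` C -> vol C <= vol B].
Proof.
move=> mP cupP PA; pose S := {X | P X}.
have [|||||[B PB] AB Bmax] := @exhaustion R S (fun X Y => sval X `<=` sval Y)
    (fun X => vol (sval X)) (vol setT) _ _ _ _ _ (exist _ A PA).
- by move=> X.
- by move=> X Y Z; exact: subset_trans.
- by move=> [X PX] [Y PY] /= XY; apply: le_vol => //; exact: mP.
- by move=> [X PX] /=; apply: le_vol => //; exact: mP.
- move=> u uS; have PU : P (\bigcup_n sval (u n)).
    by apply: cupP => // n; exact: (svalP (u n)).
  by exists (exist _ _ PU) => n; exact: (bigcup_sup (i := n)).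
- by exists B; split=> // C PC BC; exact: (Bmax (exist _ C PC)).
Qed.

End Volume.

(** * The rank function *)

Section Rank.
Context (R : realType) d (T : measurableType d).
Variables (mu : {finite_measure set T -> \bar R}) (M : measurable_matroid mu).
Implicit Types A B C F G W X Y Z : set T.
Local Notation m := (vol mu).
Local Notation r := (rank M).

Lemma indep_sub A B : measurable A -> A `<=` B -> indep M B -> indep M A.
Proof. by move=> mA AB; apply: indepS => //; exact: subset_ae. Qed.

(** By exhaustion [A] extends to an independent subset of [X] of largest volume
among those containing it. Such a set is maximal modulo null sets, so that its
volume is the rank. *)
Lemma indep_extension A X : indep M A -> measurable X -> A `<=` X ->
  exists F, [/\ indep M F, A `<=` F, F `<=` X & m F = r X].
Proof.
move=> iA mX AX.
have [|||F [[iF FX] AF Fmax]] :=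
    @set_exhaustion _ _ _ mu (fun F => indep M F /\ F `<=` X) A.
- by move=> F [/indep_measurable].
- move=> F FP FS; split; last by move=> x [n _ /(FP n).2].
  by apply: indep_bigcup => n; [have [] := FP n | exact/subset_ae/FS].
- by [].
have mF := indep_measurable iF.
exists F; split=> //.
have maxF : maximal_in mu (restr_family mu (indep M) X) F.
  split=> [|Y [iY YX] FY]; first by split=> //; exact: subset_ae.
  have mY := indep_measurable iY.
  have iFY : indep M (F `|` (Y `&` X)).
    apply: indepS iY => //; apply: vol_ae_subset => //.
    rewrite -(ae_subset_vol FY); apply: le_vol => //; sets.
  apply: vol_ae_subset => //.
  have YFX : m (Y `\` F) <= m ((F `|` (Y `&` X)) `\` F) + m (Y `\` X).
    by apply: le_trans (volU_le _ _ _) => //; apply: le_vol => //; sets.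
  apply: le_trans YFX _; rewrite (ae_subset_vol YX) addr0 volD ?subr_le0//.
  by apply: Fmax; [split=> //; sets | sets].
rewrite /rank -/(vol mu _); congr (fine _).
apply: (indep_maximal mX maxF).
by apply: (xgetPex set0 (P := maximal_in mu _)); exists F.
Qed.

Lemma le_indep_rank F X : indep M F -> measurable X -> F `<=` X -> m F <= r X.
Proof.
move=> iF mX FX; have [G [iG FG _ <-]] := indep_extension iF mX FX.
have mF := indep_measurable iF; have mG := indep_measurable iG.
exact: le_vol.
Qed.

Lemma rank_witness X : measurable X ->
  exists F, [/\ indep M F, F `<=` X & m F = r X].
Proof.
move=> mX; have [F [? _ ? ?]] := indep_extension (indep0 M) mX (sub0set X).
by exists F.
Qed.

Lemma rank_indep F : indep M F -> r F = m F.
Proof.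
move=> iF; have mF := indep_measurable iF.
have [G [iG FG GF <-]] := indep_extension iF mF (fun x => id).
by have -> : F = G by sets.
Qed.

Lemma indep_rank F : measurable F -> m F <= r F -> indep M F.
Proof.
move=> mF; have [G [iG GF <-]] := rank_witness mF => FG.
have mG := indep_measurable iG.
by apply: indepS iG => //; apply: vol_ae_subset => //; rewrite volD// subr_le0.
Qed.

Lemma rank_ge0 X : 0 <= r X.
Proof. exact: vol_ge0. Qed.

Lemma rank_vol X : measurable X -> r X <= m X.
Proof.
move=> mX; have [F [/indep_measurable mF FX <-]] := rank_witness mX.
exact: le_vol.
Qed.

Lemma rank_mono X Y : measurable X -> measurable Y -> X `<=` Y -> r X <= r Y.
Proof.
move=> mX mY XY; have [F [iF FX <-]] := rank_witness mX.
by apply: le_indep_rank => //; exact: subset_trans XY.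
Qed.

(** Extend a maximal independent set of the intersection to one of the union:
its traces on [X] and on [Y] are independent, and the inequality becomes the
modularity of the volume. *)
Lemma rank_submod X Y : measurable X -> measurable Y ->
  r (X `|` Y) + r (X `&` Y) <= r X + r Y.
Proof.
move=> mX mY; have mXY : measurable (X `&` Y) by [].
have [F [iF FXY <-]] := rank_witness mXY.
have [||G [iG FG GXY <-]] := @indep_extension F (X `|` Y) iF; [by []|by sets|].
have mF := indep_measurable iF; have mG := indep_measurable iG.
have GX : m (G `&` X) <= r X.
  by apply: le_indep_rank => //; apply: indep_sub iG => //; sets.
have GY : m (G `&` Y) <= r Y.
  by apply: le_indep_rank => //; apply: indep_sub iG => //; sets.
apply: le_trans (lerD GX GY).
rewrite -(volUI mu (measurableI _ _ mG mX) (measurableI _ _ mG mY)).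
by apply: lerD; apply: le_vol => //; sets.
Qed.

Lemma rankU_le X Y : measurable X -> measurable Y -> r (X `|` Y) <= r X + r Y.
Proof.
move=> mX mY; apply: le_trans (rank_submod mX mY).
by rewrite lerDl rank_ge0.
Qed.

Lemma rank_ae X Y : measurable X -> measurable Y -> ae_subset mu X Y ->
  r X <= r Y.
Proof.
move=> mX mY XY.
have -> : X = (X `&` Y) `|` (X `\` Y) by sets.
apply: (le_trans (rankU_le _ _)) => //.
have := @rank_vol (X `\` Y); have := @rank_mono (X `&` Y) Y.
rewrite (ae_subset_vol XY) => h1 h2; rewrite -[leRHS]addr0; apply: lerD.
  by apply: h1 => //; sets.
exact: h2.
Qed.

(** [A] spans [B] when adjoining [B] does not raise the rank; the property then
persists when further elements are adjoined to [A]. *)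
Lemma rank_spanU A B X : measurable A -> measurable B -> measurable X ->
  A `<=` B -> r B <= r A -> r (B `|` X) <= r (A `|` X).
Proof.
move=> mA mB mX AB BA.
have := rank_submod mB (measurableU _ _ mA mX).
have -> : B `|` (A `|` X) = B `|` X by sets.
have : r A <= r (B `&` (A `|` X)) by apply: rank_mono => //; sets.
lra.
Qed.

Lemma rank_spanS A A' W : measurable A -> measurable A' -> measurable W ->
  A `<=` A' -> r (A `|` W) <= r A -> r (A' `|` W) <= r A'.
Proof.
move=> mA mA' mW AA' AW.
have -> : A' `|` W = (A `|` W) `|` A' by sets.
have {2}-> : A' = A `|` A' by sets.
by apply: rank_spanU => //; sets.
Qed.

End Rank.

(** * Closure *)

Section Closure.
Context (R : realType) d (T : measurableType d).
Variables (mu : {finite_measure set T -> \bar R}) (M : measurable_matroid mu).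
Implicit Types A B C F G W X Y Z : set T.
Local Notation m := (vol mu).
Local Notation r := (rank M).

(** The rank is continuous along increasing unions, because an independent subset
of the union is exhausted by its traces. *)
Lemma rank_bigcup_le (F : nat -> set T) (c : R) :
  (forall n, measurable (F n)) -> (forall n, F n `<=` F n.+1) ->
  (forall n, r (F n) <= c) -> r (\bigcup_n F n) <= c.
Proof.
move=> mF FS Fc.
have mU : measurable (\bigcup_n F n) by exact: bigcup_measurable.
have [G [iG GF <-]] := rank_witness M mU.
have mG := indep_measurable iG.
have <- : \bigcup_n (G `&` F n) = G by rewrite -setI_bigcupr; apply/setIidPl.
apply: vol_bigcup_le => [n|n|n]; [| exact: setIS |]; first exact: measurableI.
have mFn := mF n.
apply: le_trans (Fc n); apply: le_indep_rank => //.
by apply: indep_sub iG => //; sets.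
Qed.

(** The last clause follows from maximality because, by submodularity, what does
not raise the rank of [X] does not raise that of its closure either. *)
Lemma cl_spec X : measurable X ->
  [/\ measurable (cl M X), ae_subset mu X (cl M X), r (cl M X) = r X &
      forall W, measurable W -> r (X `|` W) <= r X -> ae_subset mu W (cl M X)].
Proof.
move=> mX; set K := [set A | [/\ measurable A, ae_subset mu X A & r A = r X]].
have [|||A [[mA XA rA] _ Amax]] := @set_exhaustion _ _ _ mu
    (fun A => [/\ measurable A, X `<=` A & r A <= r X]) X.
- by move=> A [].
- move=> F FP FS; split.
  + by apply: bigcup_measurable => n _; have [] := FP n.
  + by have [_ XF _] := FP 0%N; apply: subset_trans XF _; exact: bigcup_sup.
  + by apply: rank_bigcup_le => // n; have [] := FP n.
- by split.
have [] : maximal_in mu K (cl M X).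
  apply: (xgetPex set0 (P := maximal_in mu K)); exists A; split.
    split=> //; first exact: subset_ae.
    by apply/eqP; rewrite eq_le rA rank_mono.
  move=> Y [mY XY rY] AY; apply: vol_ae_subset => //.
  have -> : Y `\` A = (A `|` Y) `\` A by sets.
  rewrite volD ?subr_le0//; apply: Amax; last by sets.
  split=> //; first by sets.
  rewrite -rY; apply: rank_ae => //; apply: vol_ae_subset => //.
  have -> : (A `|` Y) `\` Y = A `\` Y by sets.
  by rewrite (ae_subset_vol AY).
move=> [mC XC rC] Cmax; split=> // W mW XW.
suff : ae_subset mu (cl M X `|` X `|` W) (cl M X).
  move=> CXW; apply: vol_ae_subset => //; rewrite -(ae_subset_vol CXW).
  by apply: le_vol => //; sets.
apply: Cmax; last by apply: subset_ae; sets.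
have rCX : r (cl M X `|` X) <= r X.
  rewrite -rC; apply: rank_ae => //; apply: vol_ae_subset => //.
  by rewrite -(ae_subset_vol XC); apply: le_vol => //; sets.
split=> //; first by apply: subset_ae; sets.
apply/eqP; rewrite eq_le [X in _ && X]rank_mono ?andbT//; last by sets.
by apply: le_trans rCX; apply: (@rank_spanS _ _ _ _ M X) => //; sets.
Qed.

Lemma cl_closed X : measurable X -> matroid_closed M (cl M X).
Proof.
move=> mX; have [mC XC rC Cmax] := cl_spec mX.
have [mD CD rD _] := cl_spec mC; split=> //.
have DC : ae_subset mu (cl M (cl M X)) (cl M X).
  apply: Cmax => //; rewrite -rC -rD; apply: rank_ae => //.
  apply: vol_ae_subset => //.
  apply: (le_trans (y := m ((X `\` cl M X) `|` (cl M X `\` cl M (cl M X))))).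
    by apply: le_vol => //; sets.
  apply: le_trans (volU_le _ _ _) _ => //.
  by rewrite (ae_subset_vol XC) (ae_subset_vol CD) addr0.
apply: vol_null => //; apply: le_trans (volU_le _ _ _) _ => //.
by rewrite (ae_subset_vol CD) (ae_subset_vol DC) addr0.
Qed.

End Closure.

Section Expansion.
Context (R : realType) d (T : measurableType d).
Variable mu : {finite_measure set T -> \bar R}.
Implicit Types (M : measurable_matroid mu) (G W Z : set T).
Local Notation m := (vol mu).

(** [Z] is the complement of the closure of [G]; describing it by its properties
makes room for a choice that is disjoint from [G] and not only up to a null
set. *)
Definition outside_span M G Z : Prop :=
  [/\ measurable Z, Z `&` G `<=` set0, rank M (G `|` ~` Z) <= m G &
    forall W, measurable W -> rank M (G `|` W) <= m G -> m (W `&` Z) <= 0].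

(** The common consequence of the two kinds of expansion. *)
Definition expands_outside M M' (eps alpha : R) : Prop :=
  forall G, indep M G -> exists2 Z, outside_span M G Z &
    alpha * rank M setT <= rank M' Z \/
    (1 + eps) * (rank M setT - m G) <= rank M' Z.

(** A co-expanding pair is tested on the closure of [G]. An expanding pair is
tested on the closure of [E], where [E] extends [G] to a basis: as [G] and [E]
are skew, the closures of [G] and [E] meet only in loops, so that the non-loops
of the closure of [E] all lie outside the closure of [G], and they have rank
[vol E = rk - vol G]. *)
Lemma expands_outside_of M M' eps alpha : 0 < eps ->
  expanding M M' eps alpha \/ co_expanding M M' eps alpha ->
  expands_outside M M' eps alpha.
Proof.
move=> eps0 H G iG; have mG := indep_measurable iG.
have [mC GC rC Cmax] := cl_spec M mG.
have rG := rank_indep iG.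
pose Z := ~` (cl M G `|` G); exists Z.
  split; [by rewrite /Z | by rewrite /Z; sets | |].
  - rewrite -rG -rC; apply: rank_ae => //; apply: vol_ae_subset => //.
    by rewrite -(ae_subset_vol GC); apply: le_vol => //; rewrite /Z; sets.
  - move=> W mW; rewrite -rG => /(Cmax _ mW) WC.
    by rewrite -(ae_subset_vol WC); apply: le_vol => //; rewrite /Z; sets.
have ge_outside D : measurable D -> ae_subset mu D (~` cl M G) ->
    rank M' D <= rank M' Z.
  move=> mD DC; apply: rank_ae => //; apply: vol_ae_subset => //.
  apply: (le_trans (y := m ((D `\` ~` cl M G) `|` (G `\` cl M G)))).
    by apply: le_vol => //; rewrite /Z; sets.
  apply: le_trans (volU_le _ _ _) _ => //.
  by rewrite (ae_subset_vol GC) (ae_subset_vol DC) addr0.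
have eps1 : 0 <= 1 + eps by lra.
case: H => H.
- have [F [iF GF _ mF]] := indep_extension iG measurableT (@subsetT _ G).
  have mF' := indep_measurable iF.
  have mE : measurable (F `\` G) by [].
  have iE : indep M (F `\` G) by apply: indep_sub iF => //; sets.
  have [mD ED rD _] := cl_spec M mE.
  have [mL _ rL Lmax] := cl_spec M (@measurable0 _ T).
  have := H _ (cl_closed M mE).
  set D := cl M (F `\` G) in mD ED rD *; set L := cl M set0 in mL rL Lmax *.
  have r0 : rank M set0 = 0 by rewrite rank_indep ?vol0//; exact: indep0.
  have DL : ae_subset mu (D `\` L) (~` cl M G).
    (* Submodularity for [E] and [G], each enlarged by the common part [W] of
       the two closures, leaves no room for the rank of [W]; [E] is [F `\` G]. *)
    have DC : rank M (D `&` cl M G) <= 0.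
      pose W := D `&` cl M G; rewrite -/W.
      have E1 : rank M ((F `\` G) `|` W) <= m (F `\` G).
        rewrite -(rank_indep iE) -rD; apply: rank_ae => //.
        apply: vol_ae_subset => //; rewrite -(ae_subset_vol ED).
        by apply: le_vol => //; rewrite /W; sets.
      have G1 : rank M (G `|` W) <= m G.
        rewrite -rG -rC; apply: rank_ae => //.
        apply: vol_ae_subset => //; rewrite -(ae_subset_vol GC).
        by apply: le_vol => //; rewrite /W; sets.
      have mEW : measurable ((F `\` G) `|` W) by rewrite /W.
      have mGW : measurable (G `|` W) by rewrite /W.
      have := rank_submod M mEW mGW.
      have -> : ((F `\` G) `|` W) `&` (G `|` W) = W by sets.
      have : rank M F <= rank M ((F `\` G) `|` W `|` (G `|` W)).
        by apply: rank_mono => //; sets.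
      rewrite (rank_indep iF); have := volD mu mF' mG GF; lra.
    have /(ae_subset_vol (B := L)) DCL : ae_subset mu (D `&` cl M G) L.
      by apply: Lmax => //; rewrite set0U r0.
    by apply: vol_ae_subset => //; rewrite -DCL; apply: le_vol => //; sets.
  have rDL : rank M setT - m G <= rank M (D `\` L).
    have := @rankU_le _ _ _ _ M L (D `\` L).
    have : rank M D <= rank M (L `|` (D `\` L)) by apply: rank_mono => //; sets.
    rewrite rL r0 rD (rank_indep iE) volD// mF => h1 h2.
    by have := h2 ltac:(by []) ltac:(by []); lra.
  have := ge_outside (D `\` L) ltac:(by []) DL.
  move=> le1 [h|h]; [left; lra | right; apply: le_trans le1; apply: le_trans h].
  by rewrite ler_wpM2l.
- have := H _ (cl_closed M mG).
  rewrite setTD.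
  have := ge_outside (~` cl M G) ltac:(by []) (subset_ae _ (fun x => id)).
  move=> le1 [h|h]; [left; lra | right; apply: le_trans le1; apply: le_trans h].
  rewrite ler_wpM2l//.
  have := @rankU_le _ _ _ _ M (cl M G) (~` cl M G) mC ltac:(by []).
  by rewrite setUCr rC rG; lra.
Qed.

End Expansion.

(** * Alternating exchanges *)

Section Augmentation.
Context (R : realType) d (T : measurableType d).
Variable mu : {finite_measure set T -> \bar R}.
Implicit Types (M : measurable_matroid mu) (A B G I P Q V W X Z : set T).
Local Notation m := (vol mu).

Lemma indep_augment M G X : indep M G -> measurable X ->
  exists W, [/\ measurable W, W `<=` X, W `&` G `<=` set0, indep M (G `|` W) &
    m G + m W = rank M (G `|` X)].
Proof.
move=> iG mX; have mG := indep_measurable iG.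
have mGX : measurable (G `|` X) by [].
have [F [iF GF FX <-]] := indep_extension iG mGX (@subsetUl _ G X).
have mF := indep_measurable iF; exists (F `\` G); split=> //.
- by sets.
- by sets.
- by have -> : G `|` (F `\` G) = F by sets.
- by rewrite volD//; lra.
Qed.

Lemma indepU_split M G W : measurable W -> W `&` G `<=` set0 ->
  indep M (G `|` W) -> measurable G -> rank M (G `|` W) = m G + m W.
Proof. by move=> mW WG iGW mG; rewrite rank_indep// volU//; sets. Qed.

(** Extend [G `|` W] by elements of [S] to an independent set of the same span as
[S]; the elements of [S] left out form [Y]. The conclusion bounds a rank from
below; since the volume of [S `\` Y `|` W] is at most that of [S], it says that
this set is independent and spans [S]. *)
Lemma exchange_out M S G W : indep M S -> measurable G -> G `<=` S ->
  measurable W -> rank M (S `|` W) <= m S -> m G + m W <= rank M (G `|` W) ->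
  exists Y, [/\ measurable Y, Y `<=` S `\` G, m Y = m W &
    m S <= rank M (S `\` Y `|` W)].
Proof.
move=> iS mG GS mW SW GW; have mS := indep_measurable iS.
have iGW : indep M (G `|` W).
  by apply: indep_rank => //; apply: le_trans GW; exact: volU_le.
have eGW : m (G `|` W) = m G + m W.
  by apply/eqP; rewrite eq_le volU_le// (le_trans GW)// rank_indep.
have [X [mX XS XGW iF eF]] := indep_augment iGW mS.
have rF : rank M (G `|` W `|` S) = m S.
  apply/eqP; rewrite eq_le; apply/andP; split.
    by apply: le_trans SW; apply: rank_mono => //; sets.
  by rewrite -(rank_indep iS); apply: rank_mono => //; sets.
have eS : m S = m G + m X + m ((S `\` G) `\` X).
  have <- : m (G `|` X) = m G + m X by rewrite volU//; sets.
  rewrite -volU//; last by sets.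
  by congr vol; sets.
exists ((S `\` G) `\` X); split=> //; first by lra.
have eGWX : m (G `|` W `|` X) = m S by rewrite volU//; [lra | sets].
by rewrite -eGWX; apply: le_indep_rank => //; sets.
Qed.

(** Extend [S `\` Y] by elements of [W]: as [S] spans [W], the volume that can be
added is that of [Y]. Together with [exchange_out] this trims the two sides of
an exchange to equal volumes. *)
Lemma exchange_in M S Y W : indep M S -> measurable Y -> Y `<=` S ->
  measurable W -> rank M (S `|` W) <= m S -> m S <= rank M (S `\` Y `|` W) ->
  exists W', [/\ measurable W', W' `<=` W, m W' = m Y &
    m S <= rank M (S `\` Y `|` W')].
Proof.
move=> iS mY YS mW SW SYW; have mS := indep_measurable iS.
have iSY : indep M (S `\` Y) by apply: indep_sub iS => //; sets.
have [W' [mW' W'W W'S iSW' e]] := indep_augment iSY mW.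
have rSYW : rank M (S `\` Y `|` W) <= rank M (S `|` W).
  by apply: rank_mono => //; sets.
have eSY : m (S `\` Y) = m S - m Y by rewrite volD.
by exists W'; split=> //; [lra | rewrite indepU_split//; lra].
Qed.

(** A set of positive volume outside the closure of [G] need not be independent
over [G], but a part of positive volume is. *)
Lemma outside_span_indep M G Z W : indep M G -> outside_span M G Z ->
  measurable W -> W `<=` Z -> 0 < m W ->
  exists W', [/\ measurable W', W' `<=` W, 0 < m W' &
    m G + m W' <= rank M (G `|` W')].
Proof.
move=> iG [mZ _ _ ZP] mW WZ W0; have mG := indep_measurable iG.
have [W' [mW' W'W W'G iGW' e]] := indep_augment iG mW.
exists W'; split=> //; last by rewrite indepU_split.
rewrite ltNge; apply/negP => W'0.
have := ZP W mW; rewrite setIidl// => /(_ ltac:(lra)); lra.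
Qed.

Lemma indep_span_null M G W A V : measurable W -> W `&` G `<=` set0 ->
  indep M (G `|` W) -> measurable A -> measurable V -> A `<=` G ->
  rank M (A `|` V) <= m A -> m (W `&` V) <= 0.
Proof.
move=> mW WG iGW mA mV AG AV.
have iA : indep M A by apply: indep_sub iGW => //; sets.
have rWV : rank M (A `|` (W `&` V)) <= m A.
  have mGW := indep_measurable iGW.
  by apply: le_trans AV; apply: rank_mono => //; sets.
move: rWV; rewrite rank_indep; last by apply: indep_sub iGW => //; sets.
by rewrite volU//; [lra | sets].
Qed.

Variables M1 M2 : measurable_matroid mu.
Local Notation r1 := (rank M1).
Local Notation r2 := (rank M2).

(** An alternating chain of [i] exchanges ending in [W]: all the sets exchanged
have the volume of [W], [P] is the union of those that leave [I], and [Q] that of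
those that enter before [W]. In [M1] the result gains the volume of [W], as the
chain starts outside the closure of [I]; in [M2], where [W] is left out, the
exchange of [P] for [Q] preserves the span of [A]. The rank inequalities encode
independence, as the volumes cannot exceed these bounds. *)
Definition exchange I (i : nat) A W P Q : Prop :=
  [/\ [/\ measurable W, measurable P & measurable Q],
    P `<=` A, m P = m W * i%:R /\ m Q <= m W * i%:R,
    m I + m W <= r1 (I `\` P `|` Q `|` W) &
    m A <= r2 (A `\` P `|` Q) /\ r2 (A `|` Q) <= m A].

(** [A] is what is reached in [I] after [i] layers, and [V] the set that it was
chosen to span in [M2]. The last clause is what makes the layers useful: every
[W] that enters after [A] and not before is, once shrunk, the end of a chain of
[i] exchanges. *)
Definition exchange_layer I (i : nat) A V : Prop :=
  [/\ measurable A, measurable V, A `<=` I, r2 (A `|` V) <= m A &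
    forall W, measurable W -> 0 < m W -> m (W `&` V) <= 0 ->
      m (I `\` A) + m W <= r1 ((I `\` A) `|` W) ->
      exists W' P Q, [/\ W' `<=` W, 0 < m W' & exchange I i A W' P Q]].

Lemma exchange_layer0 I : measurable I -> exchange_layer I 0 set0 set0.
Proof.
move=> mI; split=> //.
  by rewrite setU0 rank_vol.
move=> W mW W0 _; rewrite setD0 => IW.
exists W, set0, set0; split=> //; split=> //.
- by rewrite vol0 mulr0.
- by rewrite setD0 setU0.
- by rewrite setD0 setU0 {1}vol0 rank_ge0; split=> //; exact: rank_vol.
Qed.

(** The bound on the change is that of a chain of [i] sets leaving and [i + 1]
sets entering, all of the same volume. *)
Definition augmentation I (i : nat) J : Prop :=
  [/\ indep M1 J, indep M2 J, m I < m J &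
    m ((I `\` J) `|` (J `\` I)) <= (m J - m I) * (2 * i%:R + 1)].

(** Some [W] in [Z] is independent over [I] in [M2]. After shrinking, it ends a
chain that [M1] accepts. [M2] accepts it too, as the chain preserves the span
of [A], over which [W] and [I \ A] together are independent. *)
Lemma exchange_layer_augment I i A V Z :
  indep M1 I -> indep M2 I -> exchange_layer I i A V ->
  outside_span M1 (I `\` A) Z -> m I < r2 (I `|` Z) ->
  exists J, augmentation I i J.
Proof.
move=> i1 i2 [mA mV AI rAV altA] oZ rIZ; have mI := indep_measurable i1.
have [mZ ZI rZ ZP] := oZ.
have iIA : indep M1 (I `\` A) by apply: indep_sub i1 => //; sets.
have [W [mW WZ WI iIW e]] := indep_augment i2 mZ.
have [W' [mW' W'W W'0 IW']] := outside_span_indep iIA oZ mW WZ ltac:(lra).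
have W'V : m (W' `&` V) <= 0.
  apply: (@indep_span_null M2 I W' A) => //; first by sets.
  by apply: indep_sub iIW => //; sets.
have [W'' [P [Q [W''W' W''0 [[mW'' mP mQ] PA [eP eQ] J1 [AP AQ]]]]]] :=
  altA W' mW' W'0 W'V IW'.
pose J := I `\` P `|` Q `|` W''; have mJ : measurable J by rewrite /J.
have PI : P `<=` I by sets.
have J_le : m J <= m I + m W''.
  apply: le_trans (volU_le _ _ _) _ => //; rewrite lerD2r.
  apply: le_trans (volU_le _ _ _) _ => //; rewrite volD//; lra.
have J2 : m I + m W'' <= r2 J.
  pose X := (I `\` A) `|` W''; have mX : measurable X by rewrite /X.
  have iIW'' : indep M2 (I `|` W'') by apply: indep_sub iIW => //; sets.
  rewrite -volU//; last by sets.
  rewrite -(rank_indep iIW'').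
  apply: (le_trans (y := r2 (A `|` Q `|` X))).
    by apply: rank_mono => //; rewrite /X; sets.
  apply: (le_trans (y := r2 (A `\` P `|` Q `|` X))).
    by apply: rank_spanU => //; [sets | exact: le_trans AQ AP].
  by apply: rank_mono => //; rewrite /X /J; sets.
have J_eq : m J = m I + m W''.
  by apply/eqP; rewrite eq_le J_le (le_trans J1)// rank_vol.
exists J; split; [| | by lra |].
- by apply: indep_rank => //; rewrite J_eq.
- by apply: indep_rank => //; rewrite J_eq.
rewrite J_eq addrAC subrr add0r.
apply: (le_trans (y := m (P `|` Q `|` W''))).
  by apply: le_vol => //; rewrite /J; sets.
apply: le_trans (volU_le _ _ _) _ => //.
have := @volU_le _ _ _ mu P Q mP mQ.
by rewrite eP => h; lra.
Qed.

(** Two exchanges in the same matroid may be performed together when one of them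
preserves a span that the other leaves alone. In [M2], the chain preserves the
span of [A], while [Y] against [U] takes place over [A]. In [M1], [Y] against [W]
preserves the span of [I \ A], while the chain takes place over it. *)
Lemma exchange_compose I i A B U P Q Y W :
  indep M1 I -> indep M2 I -> measurable A -> measurable B ->
  A `<=` B -> B `<=` I -> exchange I i A U P Q ->
  measurable Y -> Y `<=` B `\` A -> m Y = m U ->
  m B <= r2 (B `\` Y `|` U) -> r2 (B `|` U) <= m B ->
  measurable W -> m W = m U ->
  m (I `\` A) <= r1 ((I `\` A) `\` Y `|` W) ->
  r1 ((I `\` A) `|` W) <= m (I `\` A) ->
  exchange I i.+1 B W (P `|` Y) (Q `|` U).
Proof.
move=> i1 i2 mA mB AB BI [[mU mP mQ] PA [eP eQ] IPQ [AP AQ]].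
move=> mY YBA eY BYU BU mW eW SYW SW; have mI := indep_measurable i1.
have natS : m U * i.+1%:R = m U * i%:R + m U by rewrite -natr1 mulrDr mulr1.
split=> //.
- by sets.
- rewrite eW natS volU//; last by sets.
  by split; [lra | apply: le_trans (volU_le _ _ _) _ => //; lra].
- rewrite eW; apply: le_trans IPQ _.
  pose D := A `\` P `|` Q `|` U; have mD : measurable D by rewrite /D.
  apply: (le_trans (y := r1 ((I `\` A) `|` W `|` D))).
    by apply: rank_mono => //; rewrite /D; sets.
  apply: (le_trans (y := r1 ((I `\` A) `\` Y `|` W `|` D))).
    apply: rank_spanU => //; first by sets.
    by apply: le_trans SW _.
  by apply: rank_mono => //; rewrite /D; sets.
- split.
    pose D := (B `\` A) `\` Y `|` U; have mD : measurable D by rewrite /D.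
    apply: le_trans BYU _; apply: (le_trans (y := r2 (A `|` Q `|` D))).
      by apply: rank_mono => //; rewrite /D; sets.
    apply: (le_trans (y := r2 (A `\` P `|` Q `|` D))).
      by apply: rank_spanU => //; [sets | exact: le_trans AQ AP].
    by apply: rank_mono => //; rewrite /D; sets.
  have -> : B `|` (Q `|` U) = B `|` U `|` Q by sets.
  have iA : indep M2 A by apply: indep_sub i2 => //; sets.
  apply: (le_trans (y := r2 (B `|` U))) BU.
  by apply: (@rank_spanS _ _ _ _ M2 A) => //; [sets | rewrite (rank_indep iA)].
Qed.

(** The sets [B] are minimised through their complements [C] in [I], whose
increasing unions are handled by the exhaustion principle: for sets
inside an independent set, spanning [Z] passes to decreasing limits. *)
Lemma minimal_span I A Z : indep M2 I -> measurable A -> measurable Z ->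
  A `<=` I -> r2 (I `|` Z) <= m I ->
  exists B, [/\ measurable B, A `<=` B, B `<=` I, r2 (B `|` Z) <= m B &
    forall Y, measurable Y -> Y `<=` B `\` A -> 0 < m Y ->
      m (B `\` Y) < r2 ((B `\` Y) `|` Z)].
Proof.
move=> i2 mA mZ AI rIZ; have mI := indep_measurable i2.
have [|||C [[mC CIA rC] _ Cmax]] := @set_exhaustion _ _ _ mu
    (fun C => [/\ measurable C, C `<=` I `\` A &
       m C + r2 ((I `\` C) `|` Z) <= m I]) set0.
- by move=> C [].
- move=> F FP FS; have mF n : measurable (F n) by have [] := FP n.
  have mU : measurable (\bigcup_n F n) by exact: bigcup_measurable.
  split=> //; first by move=> x [n _ Fnx]; have [_ FI _] := FP n; exact: FI.
  rewrite -lerBrDr; apply: vol_bigcup_le => // n; have [_ _ h] := FP n.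
  have mFn := mF n; have FU : F n `<=` \bigcup_n F n by exact: bigcup_sup.
  rewrite lerBrDr (le_trans _ h)// lerD2l; apply: rank_mono => //; sets.
- by split=> //; rewrite vol0 add0r setD0.
have eB : m (I `\` C) = m I - m C by rewrite volD//; sets.
exists (I `\` C); split=> //; [by sets|by lra|].
move=> Y mY YB Y0; rewrite ltNge; apply/negP => h.
have eCY : m (C `|` Y) = m C + m Y by rewrite volU//; sets.
have eBY : m ((I `\` C) `\` Y) = m I - m C - m Y by rewrite volD ?eB//; sets.
have eD : I `\` (C `|` Y) = (I `\` C) `\` Y by sets.
suff : m (C `|` Y) <= m C by lra.
by apply: Cmax; [split=> //; [sets | rewrite eD; lra] | sets].
Qed.

(** A set [W] entering after [B] and not before is exchanged in [M1] against some
[Y] in the new layer [B \ A]. By minimality of [B], removing [Y] lets some [U]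
in [Z] enter in [M2]; this [U] enters after [A] and not before, hence ends a
chain of [i] exchanges once shrunk. Finally [Y] and [W] are cut down to the
volume of what is left of [U]. *)
Lemma exchange_layer_extend I i A V Z :
  indep M1 I -> indep M2 I -> exchange_layer I i A V ->
  outside_span M1 (I `\` A) Z -> r2 (I `|` Z) <= m I ->
  exists B, [/\ A `<=` B, r2 (B `|` Z) <= m B & exchange_layer I i.+1 B Z].
Proof.
move=> i1 i2 [mA mV AI rAV altA] oZ rIZ; have mI := indep_measurable i1.
have [mZ ZI rZ ZP] := oZ.
have iIA : indep M1 (I `\` A) by apply: indep_sub i1 => //; sets.
have [B [mB AB BI rB Bmin]] := minimal_span i2 mA mZ AI rIZ.
have iB : indep M2 B by apply: indep_sub i2.
exists B; split=> //; split=> // W mW W0 WZ IBW.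
(* As [W] misses [Z], it lies in the closure of [I \ A]. *)
have SW : r1 ((I `\` A) `|` W) <= m (I `\` A).
  apply: le_trans rZ; apply: rank_ae => //; apply: vol_ae_subset => //.
  by apply: le_trans WZ; apply: le_vol => //; sets.
have [||Y [mY YBA eY SYW]] := exchange_out (G := I `\` B) iIA _ _ mW SW IBW.
- by [].
- by sets.
have {}YBA : Y `<=` B `\` A by sets.
have rBY := Bmin Y mY YBA ltac:(lra).
have iBY : indep M2 (B `\` Y) by apply: indep_sub iB => //; sets.
have [U [mU UZ UB iBU eBU]] := indep_augment iBY mZ.
have UV : m (U `&` V) <= 0.
  by apply: (indep_span_null mU UB iBU mA mV _ rAV); sets.
have [U' [mU' U'U U'0 SU']] := outside_span_indep iIA oZ mU UZ ltac:(lra).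
have U'V : m (U' `&` V) <= 0.
  by apply: le_trans UV; apply: le_vol => //; sets.
have [U'' [P [Q [U''U' U''0 E]]]] := altA U' mU' U'0 U'V SU'.
have [[mU'' _ _] _ _ _ _] := E.
have U''U : U'' `<=` U by sets.
clear U'U U''U'.
have rBU'' : r2 (B `|` U'') <= m B.
  by apply: le_trans rB; apply: rank_mono => //; sets.
have BYU'' : m (B `\` Y) + m U'' <= r2 (B `\` Y `|` U'').
  rewrite indepU_split//; first by sets.
  by apply: indep_sub iBU => //; sets.
have [||Y2 [mY2 Y2Y eY2 BY2]] := exchange_out iB _ _ mU'' rBU'' BYU''.
- by [].
- by sets.
have {}Y2Y : Y2 `<=` Y by sets.
have [||W' [mW' W'W eW' SW']] := exchange_in (Y := Y2) iIA mY2 _ mW SW _.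
- by sets.
- by apply: le_trans SYW _; apply: rank_mono => //; sets.
exists W', (P `|` Y2), (Q `|` U''); split=> //; first by rewrite eW' eY2.
apply: exchange_compose E _ _ _ _ _ _ _ _ _ => //.
- by sets.
- by rewrite eW'.
- by apply: le_trans SW; apply: rank_mono => //; sets.
Qed.

End Augmentation.

(** * Growth of the reachable set *)

Lemma bernoulli_ineq (R : realType) (e : R) n :
  0 <= e -> 1 + n%:R * e <= (1 + e) ^+ n.
Proof.
move=> e0; elim: n => [|n IH]; first by rewrite mul0r addr0 expr0.
rewrite exprS -natr1; apply: (le_trans (y := (1 + e) * (1 + n%:R * e))).
  have : 0 <= n%:R * e * e by rewrite !mulr_ge0.
  lra.
by rewrite ler_wpM2l//; lra.
Qed.

Section Growth.
Context (R : realType) d (T : measurableType d).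
Variables (mu : {finite_measure set T -> \bar R}).
Variables (M1 M2 : measurable_matroid mu) (rk eps theta : R).
Implicit Types (A B I J V Z : set T).
Local Notation m := (vol mu).
Local Notation r1 := (rank M1).
Local Notation r2 := (rank M2).
Hypotheses (rk1 : r1 setT = rk) (rk2 : r2 setT = rk) (eps0 : 0 < eps).
Hypotheses (exp1 : expands_outside M1 M2 eps theta)
  (exp2 : expands_outside M2 M1 eps (1 - theta)).

Let eps1 : 0 <= 1 + eps. Proof. by rewrite addr_ge0// ltW. Qed.

(** The first bound is the expansion of [(M1, M2)] at [I \ A], whose outside [Z]
is spanned by [B] in [M2]. The second is the expansion of [(M2, M1)] at [B]: the
outside of [B] avoids [Z], hence is spanned by [I \ A] in [M1]. *)
Lemma exchange_layer_grow I i A V : indep M1 I -> indep M2 I ->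
  exchange_layer M1 M2 I i A V ->
  (exists J, augmentation M1 M2 I i J) \/
  exists B, [/\ A `<=` B,
    theta * rk <= m B \/ (1 + eps) * (rk - m I + m A) <= m B,
    (1 - theta) * rk <= m I - m A \/ (1 + eps) * (rk - m B) <= m I - m A &
    exists V', exchange_layer M1 M2 I i.+1 B V'].
Proof.
move=> i1 i2 alt; have [mA _ AI _ _] := alt; have mI := indep_measurable i1.
have iIA : indep M1 (I `\` A) by apply: indep_sub i1 => //; sets.
have [Z oZ expZ] := exp1 iIA; have [mZ ZI rZ _] := oZ.
have [rIZ|rIZ] := ltP (m I) (r2 (I `|` Z)).
  by left; exact: exchange_layer_augment alt oZ rIZ.
right; have [B [AB rB altB]] := exchange_layer_extend i1 i2 alt oZ rIZ.
have [mB _ BI _ _] := altB; have iB : indep M2 B by apply: indep_sub i2.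
exists B; split=> //; last by exists Z.
- have : r2 Z <= m B by apply: le_trans rB; apply: rank_mono => //; sets.
  move: expZ; rewrite rk1 volD// => -[h1|h1] h2; [left|right];
    apply: le_trans h2; apply: le_trans h1 => //.
  by rewrite ler_wpM2l// opprB addrCA addrC addrAC.
- have [Z' [mZ' _ _ ZP'] expZ'] := exp2 iB.
  have : r1 Z' <= m I - m A.
    rewrite -volD//; apply: le_trans rZ.
    apply: (le_trans (y := r1 (~` Z))); last by apply: rank_mono => //; sets.
    apply: rank_ae => //; apply: vol_ae_subset => //.
    by apply: le_trans (ZP' Z mZ rB); apply: le_vol => //; sets.
  by move: expZ'; rewrite rk2 => -[h1|h1] h2; [left|right]; apply: le_trans h2.
Qed.

(** Without augmentation, [N] layers bring [vol A] to [theta * rk], since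
[rk - vol I + vol A <= rk]; another [N] layers would bring [rk - vol A] below
the defect [rk - vol I], which is impossible for a subset [A] of [I]. *)
Lemma short_augmentation I N : indep M1 I -> indep M2 I -> m I < rk ->
  rk < (1 + eps) ^+ N * (rk - m I) ->
  exists i J, (i < N + N)%N /\ augmentation M1 M2 I i J.
Proof.
move=> i1 i2 Irk HN; have mI := indep_measurable i1.
pose aug n := exists i J, (i < n)%N /\ augmentation M1 M2 I i J.
have augS n : aug n -> aug n.+1.
  by move=> [i [J [lt_in ?]]]; exists i, J; split=> //; exact: ltnW.
have AI i A V : exchange_layer M1 M2 I i A V -> 0 <= m A <= m I.
  by move=> [mA _ ? _ _]; rewrite vol_ge0 le_vol.
have AB i j A B V W : exchange_layer M1 M2 I i A V ->
    exchange_layer M1 M2 I j B W -> A `<=` B -> m A <= m B.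
  by move=> [mA _ _ _ _] [mB _ _ _ _] ?; exact: le_vol.
have phase1 n : aug n \/ exists A V, exchange_layer M1 M2 I n A V /\
    (theta * rk <= m A \/ (1 + eps) ^+ n * (rk - m I) <= rk - m I + m A).
  elim: n => [|n [h|[A [V [alt H]]]]]; [right| by left; exact: augS|].
    exists set0, set0; split; first exact: exchange_layer0.
    by right; rewrite vol0 expr0; lra.
  have [[J ?]|[B [sAB g1 _ [V' altB]]]] := exchange_layer_grow i1 i2 alt.
    by left; exists n, J; split.
  right; exists B, V'; split=> //; have := AB _ _ _ _ _ _ alt altB sAB.
  case: H => [H|H] le_AB; first by left; lra.
  case: g1 => g1; [by left | right; rewrite exprS -mulrA].
  apply: (le_trans (y := (1 + eps) * (rk - m I + m A))); last by lra.
  by rewrite ler_wpM2l//; lra.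
have phase2 n : aug (N + n)%N \/ exists A V, [/\
    exchange_layer M1 M2 I (N + n) A V,
    theta * rk <= m A & (1 + eps) ^+ n * (rk - m A) <= rk].
  elim: n => [|n [h|[A [V [alt tA H]]]]].
  - rewrite addn0; have [|[A [V [alt H]]]] := phase1 N; [by left | right].
    have := AI _ _ _ alt; exists A, V; split=> //; last by rewrite expr0; lra.
    by case: H => // H; lra.
  - by left; rewrite addnS; exact: augS.
  rewrite addnS.
  have [[J ?]|[B [sAB _ g2 [V' altB]]]] := exchange_layer_grow i1 i2 alt.
    by left; exists (N + n)%N, J; split.
  right; exists B, V'; have := AB _ _ _ _ _ _ alt altB sAB => le_AB.
  split=> //; first by lra.
  case: g2 => g2; first by lra.
  rewrite exprSr -mulrA; apply: le_trans H.
  by rewrite ler_wpM2l ?exprn_ge0//; lra.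
have [//|[A [V [alt _ H]]]] := phase2 N.
have := AI _ _ _ alt => /andP[_ leAI]; exfalso.
have : (1 + eps) ^+ N * (rk - m I) <= (1 + eps) ^+ N * (rk - m A).
  by rewrite ler_wpM2l ?exprn_ge0//; lra.
lra.
Qed.

(** Twice [k] layers suffice in each phase when [k * eps] exceeds the square root
of [rk / (rk - vol I)], by squaring Bernoulli's inequality. Any bound integrable
in the defect would do for convergence; the inverse square root has the
primitive that makes the improvements telescope in [exists_full]. *)
Lemma augmentation_rate : exists2 C, 0 < C &
  forall I, indep M1 I -> indep M2 I -> m I < rk ->
  exists J, [/\ indep M1 J, indep M2 J, m I < m J &
    m (I `+` J) * Num.sqrt (rk - m I) <= C * (m J - m I)].
Proof.
have rk0 : 0 <= rk by rewrite -rk1 rank_ge0.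
exists (8 * (Num.sqrt rk / eps + Num.sqrt rk) + 1).
  have : 0 <= Num.sqrt rk / eps by rewrite divr_ge0 ?sqrtr_ge0// ltW.
  have := sqrtr_ge0 rk; lra.
move=> I i1 i2 Irk; set s := Num.sqrt rk; set q := Num.sqrt (rk - m I).
have q0 : 0 < q by rewrite sqrtr_gt0 subr_gt0.
have q2 : q ^+ 2 = rk - m I by rewrite sqr_sqrtr// subr_ge0 ltW.
have s2 : s ^+ 2 = rk by rewrite sqr_sqrtr.
have s0 : 0 <= s by exact: sqrtr_ge0.
have qs : q <= s by rewrite ler_sqrt// lerBlDr lerDl vol_ge0.
have x0 : 0 <= s / q / eps by rewrite !divr_ge0// ltW.
have /andP[k1 k2] := truncn_itv x0.
set k := (Num.truncn _).+1 in k2; rewrite -(lerD2r 1) natr1 -/k in k1.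
have [|i [J [lt_i [j1 j2 IJ dIJ]]]] := @short_augmentation I (k + k) i1 i2 Irk.
  have kq : s < k%:R * eps * q.
    by move: k2; rewrite !ltr_pdivrMr// mulrAC.
  have := @bernoulli_ineq _ eps k (ltW eps0).
  rewrite exprD -q2 -{1}s2 -expr2 -exprMn => b.
  rewrite ltr_pXn2r ?nnegrE//; last first.
    by rewrite mulr_ge0 ?exprn_ge0// ltW.
  apply: lt_le_trans kq _; rewrite ler_wpM2r//; [exact: ltW|lra].
exists J; split=> //; rewrite /setY.
apply: le_trans (ler_wpM2r (ltW q0) dIJ) _.
rewrite mulrC mulrCA [leRHS]mulrC ler_wpM2l//; first by lra.
have ik : 2 * i%:R + 1 <= 8 * k%:R :> R.
  have : (i.+1 <= k + k + (k + k))%N by [].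
  by rewrite -(ler_nat R) -natr1 !natrD; lra.
apply: (le_trans (ler_wpM2l (ltW q0) ik)).
have : q * k%:R <= s / eps + q.
  apply: (le_trans (ler_wpM2l (ltW q0) k1)).
  by rewrite mulrDr mulr1 lerD2r mulrA mulrCA divff ?mulr1 // gt_eqF.
lra.
Qed.

End Growth.

(** * Limits of augmentations *)

Section Limit.
Context (R : realType) d (T : measurableType d).
Variables (mu : {finite_measure set T -> \bar R}).
Implicit Types (I J K : set T).
Local Notation m := (vol mu).

Lemma vol_bigcup_telescope (F : nat -> set T) (a : nat -> R) (l : R) :
  (forall n, measurable (F n)) -> (forall n, m (F n) <= a n - a n.+1) ->
  (forall n, l <= a n) -> m (\bigcup_n F n) <= a 0%N - l.
Proof.
move=> mF Fa la; rewrite -bigcup_bigsetU_bigcup.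
have mG n : measurable (\big[setU/set0]_(i < n) F i).
  by apply: bigsetU_measurable.
apply: vol_bigcup_le => [//|n|n].
  by rewrite [X in _ `<=` X]big_ord_recr; exact: subsetUl.
apply: (le_trans (y := a 0%N - a n.+1)); last by have := la n.+1; lra.
elim: n.+1 => [|k IH]; first by rewrite big_ord0 vol0 subrr.
rewrite big_ord_recr /=; apply: le_trans (volU_le _ (mG k) (mF k)) _.
by apply: le_trans (lerD IH (Fa k)) _; lra.
Qed.

Lemma vol_setY_triangle I J K : measurable I -> measurable J -> measurable K ->
  m (I `+` K) <= m (I `+` J) + m (J `+` K).
Proof.
move=> mI mJ mK; apply: (le_trans (y := m ((I `+` J) `|` (J `+` K)))).
  by apply: le_vol; rewrite /setY => //; sets.
by apply: volU_le; rewrite /setY.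
Qed.

Lemma le_vol_setY I J : measurable I -> measurable J -> m I <= m J + m (I `+` J).
Proof.
move=> mI mJ; apply: (le_trans (y := m (J `|` (I `+` J)))).
  by apply: le_vol; rewrite /setY => //; sets.
by apply: volU_le; rewrite /setY.
Qed.

(** A point at which no two consecutive sets from [u n] on differ belongs to
all of them or to none. *)
Lemma setY_liminf (u : nat -> set T) n :
  u n `+` (\bigcup_p \bigcap_k u (p + k)%N) `<=`
    \bigcup_k (u (n + k)%N `+` u (n + k).+1).
Proof.
move=> x xD; apply: contrapT => nD.
have uS k : u (n + k)%N x <-> u (n + k).+1 x.
  have : ~ (u (n + k)%N `+` u (n + k).+1) x by move=> h; apply: nD; exists k.
  by rewrite /=; have := EM (u (n + k)%N x); have := EM (u (n + k).+1 x); tauto.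
have un k : u n x <-> u (n + k)%N x.
  by elim: k => [|k IH]; [rewrite addn0 | rewrite addnS -uS].
case: xD => -[h1 h2].
- by apply: h2; exists n => // k _; apply/un.
- by case: h1 => p _ /(_ n I); rewrite addnC => /un.
Qed.

(** The argument only uses that the family [P] of admissible sets is closed under
lower limits, and that a set of volume less than [rk] can be improved at the
rate given by [augmentation_rate]. *)
Section Convergence.
Variables (P : set T -> Prop) (rk C : R).
Hypotheses (mP : forall I, P I -> measurable I) (C0 : 0 < C).
Hypothesis (P_rk : forall I, P I -> m I <= rk).
Hypothesis (P_liminf : forall u : nat -> set T, (forall n, P (u n)) ->
  P (\bigcup_p \bigcap_k u (p + k)%N)).
Hypothesis (P_improve : forall I, P I -> m I < rk -> exists J,
  [/\ P J, m I < m J &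
    m (I `+` J) * Num.sqrt (rk - m I) <= C * (m J - m I)]).
Local Notation s I := (Num.sqrt (rk - m I)).

(** Here [l] is the limit of the square roots of the defects along [u], and [u]
tends to [w], so that this is the continuity of the defect. *)
Lemma limit_defect (u : nat -> set T) (w : set T) (l : R) :
  P w -> (forall n, P (u n)) -> 0 <= l ->
  (forall e, 0 < e -> exists n, s (u n) < l + e) ->
  (forall n, m (u n `+` w) <= 2 * C * (s (u n) - l)) -> s w <= l.
Proof.
have C_gt0 := C0; move=> Pw Pu l0 lP wP.
rewrite -[leRHS]ger0_norm// -sqrtr_sqr ler_sqrt ?sqr_ge0//.
rewrite leNgt; apply/negP => gap; set g := rk - m w - l ^+ 2.
have g0 : 0 < g by rewrite subr_gt0.
have [K eqK K0] : exists2 K, K = 2 * l + 1 + 2 * C & 0 < K by eexists=> //; lra.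
(* For [e <= 1], a term of [u] within [e] of the limit bounds the defect of [w]
   by [l ^+ 2 + e * K]; this choice of [e] makes [e * K] less than [g]. *)
have [e [e0 e1 eK]] : exists e, [/\ 0 < e, e <= 1 & e * K + e * g = g].
  have Kg : 0 < K + g by rewrite addr_gt0.
  exists (g / (K + g)); split; first by rewrite divr_gt0.
  - by rewrite ler_pdivrMr// mul1r lerDr ltW.
  - by rewrite -mulrDr divfK// gt_eqF.
have [n sn] := lP _ e0.
have eg : 0 < e * g by rewrite mulr_gt0.
have := le_vol_setY (mP (Pu n)) (mP Pw); have := wP n.
have s2 : s (u n) ^+ 2 = rk - m (u n) by rewrite sqr_sqrtr// subr_ge0 P_rk.
have sl : s (u n) ^+ 2 <= l ^+ 2 + e * (2 * l + 1).
  apply: (le_trans (y := (l + e) ^+ 2)).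
    by rewrite lerXn2r ?nnegrE ?sqrtr_ge0 ?addr_ge0// ltW.
  have : e * e <= e * 1 by rewrite ler_wpM2l// ltW.
  rewrite sqrrD; lra.
have Ce : 2 * C * (s (u n) - l) <= 2 * C * e.
  by rewrite ler_wpM2l//; lra.
rewrite eqK /g in eK eg; lra.
Qed.

(** Order the admissible sets by: [J] improves [I] when the square root of the
defect drops by at least a constant times the volume of the symmetric
difference. Along a sequence of improvements the differences telescope, so that
the lower limit improves on all terms, and exhaustion yields an admissible set
without strict improvement. By the rate bound it has volume [rk]. *)
Lemma exists_full : (exists I, P I) -> exists2 I, P I & m I = rk.
Proof.
have C_gt0 := C0; move=> [I0 PI0]; pose S := {I | P I}.
pose le (I J : S) := m (sval I `+` sval J) <= 2 * C * (s (sval I) - s (sval J)).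
have sP (I : S) : P (sval I) by exact: (svalP I).
have le_s (I J : S) : le I J -> s (sval J) <= s (sval I).
  move=> /(le_trans (vol_ge0 _ _)); rewrite pmulr_rge0 ?subr_ge0//; lra.
have [|||||[I PI] _ Imax] := @exhaustion R S le (fun I : S => m (sval I)) rk
    _ _ _ _ _ (exist _ I0 PI0).
- by move=> I; rewrite /le /setY setDv setU0 vol0 subrr mulr0.
- move=> I J K IJ JK.
  have := vol_setY_triangle (mP (sP I)) (mP (sP J)) (mP (sP K)).
  move=> /le_trans; apply.
  by apply: le_trans (lerD IJ JK) _; lra.
- move=> I J /le_s; rewrite ler_sqrt ?subr_ge0 ?P_rk//; first by lra.
- by move=> I; exact: P_rk.
- move=> u uS; have Pu n := sP (u n).
  have Pw := P_liminf Pu; set w := \bigcup_p _ in Pw.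
  pose a n := s (sval (u n)).
  have inf_a : has_inf (range a).
    by split; [exists (a 0%N), 0%N | exists 0 => _ [n _ <-]; exact: sqrtr_ge0].
  have la n : inf (range a) <= a n.
    by apply: ge_inf; [exact: inf_a.2 | exists n].
  have uw n : m (sval (u n) `+` w) <= 2 * C * (a n - inf (range a)).
    apply: (le_trans (y :=
        m (\bigcup_k (sval (u (n + k)%N) `+` sval (u (n + k).+1))))).
      apply: le_vol; last exact: (@setY_liminf (fun n => sval (u n))).
      - by have := mP Pw; have := mP (Pu n); rewrite /setY.
      - apply: bigcup_measurable => k _.
        by have := mP (Pu (n + k)%N); have := mP (Pu (n + k).+1); rewrite /setY.
    have -> : a n = a (n + 0)%N by rewrite addn0.
    rewrite mulrBr.
    apply: (vol_bigcup_telescope (a := fun k => 2 * C * a (n + k)%N)).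
    - move=> k; have := mP (Pu (n + k)%N); have := mP (Pu (n + k).+1).
      by rewrite /setY.
    - by move=> k; rewrite addnS -mulrBr; exact: uS.
    - by move=> k; rewrite ler_pM2l//; lra.
  have wl : s w <= inf (range a).
    apply: (limit_defect Pw Pu) => //.
    - apply: lb_le_inf; first exact: inf_a.1.
      by move=> _ [n _ <-]; exact: sqrtr_ge0.
    - move=> e e0; have [_ [n _ <-] lt_n] := inf_adherent e0 inf_a.
      by exists n.
  exists (exist _ w Pw) => n; apply: le_trans (uw n) _.
  by rewrite ler_pM2l ?lerB//; lra.
exists I => //; apply/eqP; rewrite eq_le P_rk//= leNgt; apply/negP => Irk.
have [J [PJ IJ dIJ]] := P_improve PI Irk.
suff : le (exist _ I PI) (exist _ J PJ) by move=> /Imax /=; rewrite leNgt IJ.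
have sI0 : 0 < s I by rewrite sqrtr_gt0 subr_gt0.
rewrite /le /= -(ler_pM2r sI0); apply: le_trans dIJ _.
have sI2 : s I ^+ 2 = rk - m I by rewrite sqr_sqrtr// subr_ge0 P_rk.
have sJ2 : s J ^+ 2 = rk - m J by rewrite sqr_sqrtr// subr_ge0 P_rk.
have -> : m J - m I = s I ^+ 2 - s J ^+ 2 by lra.
have sJI : s J <= s I by rewrite ler_sqrt ?subr_ge0 ?P_rk//; lra.
rewrite -subr_ge0.
have -> : 2 * C * (s I - s J) * s I - C * (s I ^+ 2 - s J ^+ 2) =
  C * (s I - s J) ^+ 2 by ring.
by rewrite mulr_ge0 ?sqr_ge0// ltW.
Qed.

End Convergence.
End Limit.

(** * Common bases *)

Section Bases.
Context (R : realType) d (T : measurableType d).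
Variables (mu : {finite_measure set T -> \bar R}) (M : measurable_matroid mu).

Lemma indep_liminf (u : nat -> set T) : (forall n, indep M (u n)) ->
  indep M (\bigcup_p \bigcap_k u (p + k)%N).
Proof.
move=> iu; apply: indep_bigcup => n.
  apply: indep_sub (iu n); last by move=> x /(_ 0%N I); rewrite addn0.
  by apply: bigcap_measurable => // k _; exact: indep_measurable (iu _).
by apply: subset_ae => x ux k _; rewrite addSnnS; exact: ux.
Qed.

Lemma full_basis B : indep M B -> vol mu B = rank M setT -> basis_of_matroid M B.
Proof.
move=> iB eB; split=> // Y iY BY.
have mB := indep_measurable iB; have mY := indep_measurable iY.
apply: vol_ae_subset => //; rewrite setDE.
have iYB : indep M (B `&` Y) by apply: indep_sub iB.
have := volID mu mY mB; have := volID mu mB mY.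
rewrite (ae_subset_vol BY) setIC -setDE.
have := le_indep_rank iY measurableT (@subsetT _ Y).
lra.
Qed.

End Bases.

Theorem theorem6p18 (R : realType) (d : measure_display) (T : measurableType d)
    (mu : {finite_measure set T -> \bar R}) (hmu : standard_measure_space mu)
    (M1 M2 : measurable_matroid mu)
    (rk : R) (hrk1 : rank M1 setT = rk) (hrk2 : rank M2 setT = rk)
    (eps theta : R) (heps : 0 < eps) (htheta : 0 <= theta <= 1)
    (ha : expanding M1 M2 eps theta \/ co_expanding M1 M2 eps theta)
    (hb : expanding M2 M1 eps (1 - theta) \/ co_expanding M2 M1 eps (1 - theta)) :
  exists B : set T, basis_of_matroid M1 B /\ basis_of_matroid M2 B.
Proof.
have exp1 := expands_outside_of heps ha; have exp2 := expands_outside_of heps hb.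
have [C C0 improve] := augmentation_rate hrk1 hrk2 heps exp1 exp2.
have [|||||B [i1 i2] eB] := @exists_full _ _ _ mu
  (fun I => indep M1 I /\ indep M2 I) rk C _ C0.
- by move=> I [/indep_measurable].
- by move=> I [i1 _]; rewrite -hrk1; apply: le_indep_rank.
- by move=> u iu; split; apply: indep_liminf => n; have [] := iu n.
- move=> I [i1 i2] Irk; have [J [? ? ? ?]] := improve I i1 i2 Irk.
  by exists J.
- by exists set0; split; exact: indep0.
by exists B; split; apply: full_basis; rewrite // ?hrk1 ?hrk2.
Qed.
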